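(* For integers $n\ge 6$, $$\frac{5}{6}\binom{n}{2} \le f(n, 6, 14) \le \frac{5}{6}\binom{n}{2}+O(n),$$ where the implied constant is absolute. Furthermore, $f(n,6,14)=\frac56\binom n2$ whenever $n\ge 6$ is congruent to $1$ or $4$ modulo $12$.
   Context: For integers $p\ge 3$ and $2\le q\le \binom p2$, a $(p,q)$-coloring of the complete graph $K_n$ is a coloring of the edges of $K_n$ (not necessarily proper) such that every $p$-clique has at least $q$ distinct colors among its edges. The generalized Ramsey number $f(n,p,q)$ is the minimum number of colors for which $K_n$ has a $(p,q)$-coloring. *)

(* Defs.v *)
From mathcomp Require Import all_boot.

Set Implicit Arguments.
Unset Strict Implicit.
Unset Printing Implicit Defensive.

Definition edge (n : nat) : finType := {e : {set 'I_n} | #|e| == 2}.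

Definition colors_on n k (c : {ffun edge n -> 'I_k}) (S : {set 'I_n}) :
    {set 'I_k} :=
  [set c e | e : edge n & val e \subset S].

Definition pq_coloring n p q k (c : {ffun edge n -> 'I_k}) : bool :=
  [forall S : {set 'I_n}, (#|S| == p) ==> (q <= #|colors_on c S|)].

(* The palette has k colors; c is not required to use all of them, which does
   not affect the minimum below. *)
Definition pq_colorable n p q k : bool :=
  [exists c : {ffun edge n -> 'I_k}, pq_coloring p q c].

(* f(n, p, q). The search is bounded by 'C(n, 2): if q <= 'C(p, 2), giving all
   edges different colors is a (p, q)-coloring, so this is the true minimum
   (gen_ramseyP). Otherwise the value 'C(n, 2) may be a junk default. *)
Definition gen_ramsey (n p q : nat) : nat :=
  [arg min_(k < ord_max : 'I_('C(n, 2).+1) | pq_colorable n p q k) (k : nat)].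

Lemma card_edge n : #|edge n| = 'C(n, 2).
Proof.
rewrite card_sig -[in RHS](card_ord n) -card_draws.
by apply: eq_card => e; rewrite !inE.
Qed.

Lemma pq_colorable_rainbow n p q : q <= 'C(p, 2) -> pq_colorable n p q 'C(n, 2).
Proof.
move=> le_q; apply/existsP.
exists [ffun e => cast_ord (card_edge n) (enum_rank e)].
apply/forallP => S; apply/implyP => /eqP cardS.
rewrite /colors_on card_imset; last first.
  by move=> e1 e2; rewrite !ffunE => /cast_ord_inj/enum_rank_inj.
apply: leq_trans le_q _; rewrite -cardS -cards_draws.
rewrite -[leqRHS](card_imset _ val_inj); apply: subset_leq_card.
apply/subsetP => e.
rewrite inE => /andP[sub_eS e2]; apply/imsetP.
by exists (exist _ e e2 : edge n); rewrite ?inE.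
Qed.

Lemma gen_ramseyP n p q : q <= 'C(p, 2) ->
  pq_colorable n p q (gen_ramsey n p q) /\
  (forall k, pq_colorable n p q k -> gen_ramsey n p q <= k).
Proof.
move=> le_q; rewrite /gen_ramsey.
case: arg_minnP => [|i col_i min_i]; first exact: pq_colorable_rainbow.
split=> // k col_k; have [lt_k|le_k] := ltnP k 'C(n, 2).+1.
  exact: (min_i (Ordinal lt_k)).
exact: leq_trans (ltnW (ltn_ord i)) le_k.
Qed.

(* Main.v *)
Require Import Defs.
From HB Require Import structures.
From mathcomp Require Import all_boot all_order all_algebra.
From mathcomp Require Import zify ring lra.

(** Lower bound.  In a (6,14)-coloring six vertices carry at most one repeated
color.  Hence each color is used at most twice, and if two colors are both
used twice then the vertex sets spanned by these two pairs of edges have at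
least seven vertices in their union (two_repeats).  Such a vertex set has three
or four elements; two of them with four elements share at most one vertex, and
one with three elements is disjoint from all the others.  Give each repeated
color the ordered pairs of distinct vertices inside its vertex set, or starting
in it if this has three elements (arcs): these are at least twelve, and distinct
colors have no pair in common, so at most 'C(n, 2) / 6 colors are
repeated and at least 5/6 of 'C(n, 2) colors are needed.

Upper bound.  Given a Steiner system S(2,4,n), choose in each block a perfect
matching, give its two edges one color and all other edges different colors.
This saves one color per block, that is 'C(n, 2) / 6 colors.  Two distinct blocks
have at least seven points together, so six vertices contain at most one
complete block and see at most one repetition (colorable_of_steiner4).  For
arbitrary n, restrict a coloring of the least complete graph of order at least
n that is 1 or 4 modulo 12.

Existence of S(2,4,n) for all n = 1, 4 modulo 12 (Hanani).  Write n = 3u + 1,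
where u is 0 or 1 modulo 4.  Deleting a point from S(2,4,n) leaves a group
divisible design with u groups of size 3 and blocks of size 4, and conversely
the point can be put back (steiner4_of_gdd3); gdd3 u says that such a design
exists.  If u points carry a linear space all of whose line sizes v satisfy
gdd3 v, then gdd3 u holds, by putting a design on each line (pbd_closure).
Over the integers modulo t, with t coprime to 6, arithmetic lines give a
transversal design with five groups of size t; truncating one group to h
points and possibly adding a point at infinity gives linear spaces on
4 t + h + e points, with e = 0 or 1, whose lines have sizes 4, 5, t + e and
h + e (gdd3_truncation).  These recursions reach every admissible u except 0
and 1, where nothing is required, and thirteen values up to 44, which are given by explicit difference families
(gdd3_difference_family), or for u = 4 by a transversal design (gdd3_exists). *)

Set Implicit Arguments.
Unset Strict Implicit.
Unset Printing Implicit Defensive.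

Import Order.TTheory GRing.Theory Num.Theory.

(** * Partial linear spaces and group divisible designs *)

Section PartialLinearSpaces.
Implicit Types T : finType.

(** A partial linear space on [T] with collinearity relation [R]: [L p q] is the
line through the collinear points [p] and [q].  The last clause says that any
two points of a line are collinear and lie on no other line. *)
Definition linear_space T (R : rel T) (L : T -> T -> {set T}) :=
  forall p q, R p q -> [/\ p \in L p q, q \in L p q &
    forall r s, r \in L p q -> s \in L p q -> r != s ->
      R r s /\ L r s = L p q].

(** There is a partial linear space with collinearity relation [R] and all lines
of size 4: a Steiner system S(2,4,n) when [R] is the relation of being distinct,
a group divisible design when [R] is the relation of being in distinct groups. *)
Definition steiner4 T (R : rel T) :=
  exists2 L, linear_space R L & forall p q, R p q -> #|L p q| = 4.

(** A family of sets such that two collinear points are in a common member, two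
points of a member are collinear, and two points determine the member, is the
family of lines of a partial linear space.  Members with at most one point are
harmless. *)
Lemma linear_of_family T (R : rel T) (J : finType) (b : J -> {set T}) :
    (forall p q, R p q -> p != q) ->
    (forall p q, R p q -> exists j, (p \in b j) && (q \in b j)) ->
    (forall j p q, p \in b j -> q \in b j -> p != q -> R p q) ->
    (forall i j p q, p \in b i -> q \in b i -> p \in b j -> q \in b j ->
       p != q -> b i = b j) ->
  exists2 L, linear_space R L &
    forall p q, R p q -> exists2 j, L p q = b j & (p \in b j) && (q \in b j).
Proof.
move=> Rneq cov inR uniqb.
pose L p q := if [pick j | (p \in b j) && (q \in b j)] is Some j then b j else set0.
have LE p q : R p q -> exists2 j, L p q = b j & (p \in b j) && (q \in b j).
  move=> /cov[j0 j0P]; rewrite /L; case: pickP => [j jP|/(_ j0)]; first by exists j.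
  by rewrite j0P.
exists L => // p q Rpq; have [j -> /andP[pj qj]] := LE p q Rpq.
split=> // r s rj sj nrs; have Rrs := inR _ _ _ rj sj nrs; split=> //.
by have [i -> /andP[ri si]] := LE r s Rrs; apply: uniqb nrs.
Qed.

Lemma steiner4_of_family T (R : rel T) (J : finType) (b : J -> {set T}) :
    (forall p q, R p q -> p != q) ->
    (forall p q, R p q -> exists j, (p \in b j) && (q \in b j)) ->
    (forall j p q, p \in b j -> q \in b j -> p != q -> R p q /\ #|b j| = 4) ->
    (forall i j p q, p \in b i -> q \in b i -> p \in b j -> q \in b j ->
       p != q -> b i = b j) ->
  steiner4 R.
Proof.
move=> Rneq cov inR uniqb.
have [|L linL LE] := @linear_of_family T R J b Rneq cov _ uniqb.
  by move=> j p q pj qj npq; case: (inR j p q).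
exists L => // p q Rpq; have [j -> /andP[pj qj]] := LE p q Rpq.
by have [] := inR j p q pj qj (Rneq _ _ Rpq).
Qed.

Lemma steiner4_pull T T' (R : rel T) (R' : rel T') (f : T' -> T) :
    injective f -> (forall x y, R' x y = R (f x) (f y)) ->
    (forall y z, R y z -> y \in codom f) -> (forall y z, R y z -> y != z) ->
  steiner4 R -> steiner4 R'.
Proof.
move=> f_inj RE Rcod Rneq [L linL L4].
exists (fun x y => f @^-1: L (f x) (f y)).
  move=> p q; rewrite RE => /linL[pL qL linLpq]; rewrite !inE; split=> // r s.
  rewrite !inE => rL sL nrs; rewrite RE.
  by have [|-> ->] := linLpq _ _ rL sL; rewrite ?inj_eq.
move=> p q; rewrite RE => Rpq; rewrite -(L4 _ _ Rpq) -(card_imset _ f_inj).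
have [pL qL linLpq] := linL _ _ Rpq.
apply: eq_card => r; apply/imsetP/idP => [[x]|rL]; first by rewrite inE => xL ->.
have /codomP[x rE] : r \in codom f.
  have [->|nrp] := eqVneq r (f p); first exact: codom_f.
  by have [/Rcod] := linLpq _ _ rL pL nrp.
by exists x; rewrite // inE -rE.
Qed.

Lemma steiner4_push T T' (R : rel T) (R' : rel T') (f : T' -> T) :
    injective f -> (forall x y, R' x y = R (f x) (f y)) ->
    (forall y z, R y z -> (y \in codom f) && (z \in codom f)) ->
    (forall y z, R y z -> y != z) ->
  steiner4 R' -> steiner4 R.
Proof.
move=> f_inj RE Rcod Rneq [L linL L4].
pose b (j : T' * T') := if R' j.1 j.2 then f @: L j.1 j.2 else set0.
have bP j p : p \in b j -> R' j.1 j.2 /\ exists2 x, x \in L j.1 j.2 & p = f x.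
  by rewrite /b; case: ifP => [_ /imsetP//|_]; rewrite inE.
apply: (@steiner4_of_family _ _ _ b) => //.
- move=> p q Rpq; have /andP[/codomP[x pE] /codomP[y qE]] := Rcod _ _ Rpq.
  exists (x, y); rewrite /b RE -pE -qE Rpq pE qE !mem_imset //=.
  by rewrite pE qE -RE in Rpq; have [-> ->] := linL _ _ Rpq.
- move=> j _ _ /bP[Rj [x xL ->]] /bP[_ [y yL ->]]; rewrite (inj_eq f_inj) => nxy.
  have [_ _ /(_ _ _ xL yL nxy)[Rxy _]] := linL _ _ Rj; rewrite -RE; split=> //.
  by rewrite /b Rj card_imset // L4.
move=> i j _ _ /bP[Ri [x xi ->]] /bP[_ [y yi ->]] xj yj; rewrite (inj_eq f_inj) => nxy.
have [_ [x' x'j /f_inj xE]] := bP _ _ xj; have [Rj [y' y'j /f_inj yE]] := bP _ _ yj.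
rewrite -xE -yE in x'j y'j *; rewrite /b Ri Rj.
have [_ _ /(_ _ _ xi yi nxy)[_ <-]] := linL _ _ Ri.
by have [_ _ /(_ _ _ x'j y'j nxy)[_ <-]] := linL _ _ Rj.
Qed.

(** Being distinct points of [A]: the collinearity relation of a linear space (or
pairwise balanced design) on [A]. *)
Definition ne_in T (A : {set T}) : rel T :=
  [rel x y | [&& x \in A, y \in A & x != y]].

(** Group divisible designs with groups of size 3 indexed by the points of [A]:
the group of [x] consists of the points [(x, i)]. *)
Definition gdd_rel T (A : {set T}) : rel (T * 'I_3) :=
  [rel p q | ne_in A p.1 q.1].

(** There is a group divisible design with [u] groups of size 3 and blocks of
size 4.  It amounts to a Steiner system S(2,4,3u+1). *)
Definition gdd3 u := steiner4 (gdd_rel [set: 'I_u]).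

Lemma gdd3_card T (A : {set T}) : steiner4 (gdd_rel A) <-> gdd3 #|A|.
Proof.
pose f (p : 'I_#|A| * 'I_3) : T * 'I_3 := (enum_val p.1, p.2).
have f_inj : injective f by case=> [x i] [y j] [/enum_val_inj-> ->].
have RE p q : gdd_rel [set: 'I_#|A|] p q = gdd_rel A (f p) (f q).
  by rewrite /gdd_rel /ne_in /= !inE !enum_valP (inj_eq enum_val_inj).
have Aim x i : x \in A -> (x, i) \in codom f.
  by move=> Ax; apply/codomP; exists (enum_rank_in Ax x, i); rewrite /f /= enum_rankK_in.
have Rcod y z : gdd_rel A y z -> (y \in codom f) && (z \in codom f).
  by case: y z => [x i] [y j] /and3P[/= xA yA _]; rewrite !Aim.
have Rneq y z : gdd_rel A y z -> y != z.
  by case: y z => [x i] [y j] /and3P[/= _ _]; apply: contraNneq => -[->].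
split; last exact: steiner4_push RE Rcod Rneq.
by apply: steiner4_pull RE _ Rneq => // y z /Rcod/andP[].
Qed.

(** Wilson's construction with weight 3: replace each line of a linear space by a
group divisible design on the groups indexed by its points. *)
Lemma pbd_closure T (A : {set T}) (L : T -> T -> {set T}) :
    linear_space (ne_in A) L ->
    (forall x y, ne_in A x y -> gdd3 #|L x y|) -> gdd3 #|A|.
Proof.
move=> linL gddL; apply: (gdd3_card A).1.
pose isline B := [exists p, ne_in A p.1 p.2 && (B == L p.1 p.2)].
(* The design must depend only on the line, not on the two points spanning it. *)
have /fin_all_exists[G GP] (B : {set T}) :
    exists G, isline B -> linear_space (gdd_rel B) G /\
       forall p q, gdd_rel B p q -> #|G p q| = 4.
  have [/existsP[p /andP[Ap /eqP->]]|_] := boolP (isline B); last first.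
    by exists (fun _ _ => set0).
  by have [G linG G4] := (gdd3_card (L p.1 p.2)).2 (gddL _ _ Ap); exists G.
have lineP x y : ne_in A x y -> isline (L x y).
  by move=> Axy; apply/existsP; exists (x, y); rewrite Axy /=.
have inL (p q : T * 'I_3) : gdd_rel A p q -> gdd_rel (L p.1 q.1) p q.
  by move=> Apq; have [pL qL _] := linL _ _ Apq; case/and3P: Apq => *; apply/and3P.
exists (fun p q => G (L p.1 q.1) p q) => [p q Apq|p q Apq]; last first.
  have [_ ->//] := GP _ (lineP _ _ Apq); exact: inL.
have [/(_ p q (inL _ _ Apq))[pG qG linG] _] := GP _ (lineP _ _ Apq).
split=> // r s rG sG nrs; have [Lrs <-] := linG _ _ rG sG nrs.
have [_ _ linLpq] := linL _ _ Apq; case/and3P: Lrs => rL sL nrs1.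
by have [Ars ->] := linLpq _ _ rL sL nrs1.
Qed.

End PartialLinearSpaces.

(** * Transversal designs from arithmetic lines *)

Section TransversalDesigns.
Variables k t : nat.
Hypothesis t_gt1 : 1 < t.
Hypothesis t_coprime : forall d, 0 < d < k -> coprime t d.

(** Transversal design with groups indexed by [option 'I_k], on the points
[(i, x)] with [x] modulo [t].  The block with parameter [c = (a, b)] meets the
group of [Some j] in [j * a + b] and the group of [None] in [a]; thus [j] runs
over slopes. *)
Definition td_val (i : option 'I_k) (c : 'Z_t * 'Z_t) : 'Z_t :=
  (if i is Some j then (j : nat)%:R * c.1 + c.2 else c.1)%R.

(** Two points in distinct groups determine the block: slopes differ by less than
[k], hence by a unit modulo [t]. *)
Lemma td_val_inj i j c c' : i != j ->
  td_val i c = td_val i c' -> td_val j c = td_val j c' -> c = c'.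
Proof.
case: c c' => [a b] [a' b'].
have key (i' j' : 'I_k) : i' < j' ->
    td_val (Some i') (a, b) = td_val (Some i') (a', b') ->
    td_val (Some j') (a, b) = td_val (Some j') (a', b') -> (a, b) = (a', b').
  move=> lt_ij /= Ei Ej.
  have aE : a = a'.
    have U : ((j' - i')%:R : 'Z_t)%R \is a GRing.unit.
      rewrite unitZpE // t_coprime // subn_gt0 lt_ij /=.
      by rewrite (leq_ltn_trans (leq_subr _ _)).
    have D (x y : 'Z_t) :
        ((j' - i')%:R * x = (j'%:R * x + y) - (i'%:R * x + y))%R.
      by rewrite natrB ?(ltnW lt_ij) // mulrBl opprD addrACA subrr addr0.
    by apply: (mulrI U); rewrite (D a b) (D a' b') Ei Ej.
  by rewrite aE in Ei *; congr pair; apply: addrI Ei.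
case: i j => [i|] [j|] // nij.
- case: (ltngtP i j) nij => [lt_ij|lt_ji|/val_inj->]; last by rewrite eqxx.
    by move=> _; apply: key.
  by move=> _ Ei Ej; apply: key lt_ji Ej Ei.
- by move=> Ei /= aE; rewrite /= aE in Ei *; congr pair; apply: addrI Ei.
by move=> /= aE Ej; rewrite aE in Ej *; congr pair; apply: addrI Ej.
Qed.

(** Two points in distinct groups are in a common block, by injectivity and
equality of cardinals. *)
Lemma td_val_ex i j x y : i != j -> exists c, td_val i c = x /\ td_val j c = y.
Proof.
move=> nij; pose f c := (td_val i c, td_val j c).
have f_inj : injective f.
  move=> c c' /eqP; rewrite xpair_eqE => /andP[/eqP Ei /eqP Ej].
  exact: td_val_inj nij Ei Ej.
have /codomP[c /eqP] := inj_card_onto f_inj (leqnn _) (x, y).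
by rewrite xpair_eqE => /andP[/eqP-> /eqP->]; exists c.
Qed.

End TransversalDesigns.

(** With fewer than two groups no two points are collinear. *)
Lemma gdd3_lt2 u : u < 2 -> gdd3 u.
Proof.
move=> u2; have R0 (p q : 'I_u * 'I_3) : gdd_rel [set: 'I_u] p q -> False.
  case: p q => [[x xu] i] [[y yu] j] /and3P[_ _] /=; rewrite -val_eqE /=; lia.
by exists (fun _ _ => set0) => p q /R0.
Qed.

(** A transversal design with four groups of size 3 is the required design. *)
Lemma gdd3_4 : gdd3 4.
Proof.
have <-: #|[set: option 'I_3]| = 4 by rewrite cardsT card_option card_ord.
apply: (gdd3_card _).1.
have cop d : 0 < d < 3 -> coprime 3 d by case: d => [|[|[|]]].
pose b c : {set option 'I_3 * 'I_3} := [set (i, td_val i c : 'Z_3) | i : option 'I_3].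
have inb c (p : option 'I_3 * 'I_3) : (p \in b c) = (p.2 == td_val p.1 c :> 'Z_3).
  apply/imsetP/eqP => [[i _ ->]//|E]; exists p.1 => //.
  by case: p E => i x /= ->.
apply: (@steiner4_of_family _ _ _ b).
- by move=> [x i] [y j] /and3P[_ _]; apply: contraNneq => -[->].
- case=> [i x] [j y] /and3P[/= _ _ nij].
  have [c [xE yE]] := td_val_ex (isT : 1 < 3) cop x y nij.
  by exists c; rewrite !inb /= xE yE !eqxx.
- move=> c [i x] [j y]; rewrite !inb /= => /eqP-> /eqP-> nij; split; last first.
    by rewrite card_imset ?card_option ?card_ord // => i1 j1 [].
  by rewrite /gdd_rel /ne_in /= !inE; apply: contraNneq nij => ->.
move=> c c' [i x] [j y]; rewrite !inb /= => /eqP-> /eqP-> /eqP Ei /eqP Ej nij.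
suff -> : c = c' by [].
have nij' : i != j by apply: contraNneq nij => ->.
by apply: (td_val_inj (isT : 1 < 3) cop nij').
Qed.

(** * Truncated transversal designs *)

Lemma card_set_option (T : finType) (A : {set option T}) :
  #|A| = (None \in A) + #|[set x | Some x \in A]|.
Proof.
rewrite (cardsD1 None A); congr (_ + _).
rewrite -(card_imset [set x | Some x \in A] (@Some_inj _)); apply: eq_card => -[x|].
  by rewrite mem_imset ?inE //; apply: Some_inj.
by rewrite !inE; apply/esym/imsetP => -[].
Qed.

Lemma card_set_pair (T1 T2 : finType) (A : {set T1 * T2}) :
  #|A| = \sum_x #|[set y | (x, y) \in A]|.
Proof.
rewrite -sum1_card (eq_bigr (fun x => \sum_(y | (x, y) \in A) 1)); last first.
  by move=> x _; rewrite -sum1_card; apply: eq_bigl => y; rewrite inE.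
by rewrite pair_big_dep; apply: eq_bigl => -[].
Qed.

Lemma card_ord_lt n h : h <= n -> #|[set x : 'I_n | x < h]| = h.
Proof.
move=> le_hn; rewrite -[RHS]card_ord.
have w_inj : injective (widen_ord le_hn) by move=> i j /(congr1 val) /= /val_inj.
rewrite -(card_imset _ w_inj); apply: eq_card => x; rewrite inE.
apply/idP/imsetP => [xh|[i _ ->]]; last exact: (ltn_ord i).
by exists (Ordinal xh); rewrite ?inE //; apply: val_inj.
Qed.

Section TruncatedTransversalDesign.
Variables (t h : nat) (e : bool).
Hypotheses (t_gt1 : 1 < t) (t6 : coprime t 6) (le_ht : h <= t).

(** Points of the transversal design with five groups of size [t], and a point at
infinity [None]. *)
Let point : finType := option (option 'I_4 * 'Z_t).

(** The group of index [None] is truncated to [h] points; the point at infinity is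
kept when [e] holds. *)
Definition in_trunc (z : point) :=
  if z is Some (i, x) then (i == None) ==> (x < h) else e.

Definition trunc_set := [set z | in_trunc z].

(** The lines are the truncated blocks, [inl c], and the truncated groups, each
completed by the point at infinity if it is kept, [inr i]. *)
Definition trunc_line (j : 'Z_t * 'Z_t + option 'I_4) : {set point} :=
  [set z | in_trunc z & match j, z with
     | inl c, Some (i, x) => x == td_val i c
     | inl _, None => false
     | inr i0, Some (i, _) => i == i0
     | inr _, None => true
     end].

Let cop d : 0 < d < 4 -> coprime t d.
Proof.
move=> /andP[d0 d4]; apply: coprime_dvdr t6.
by case: d d0 d4 => [|[|[|[|]]]].
Qed.

Let card_col i : #|[set x : 'Z_t | (i == None :> option 'I_4) ==> (x < h)]| =
  if i == None then h else t.
Proof.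
have tE : (Zp_trunc t).+2 = t by rewrite Zp_cast.
case: eqP => [_|_]; last first.
  by rewrite -[RHS]tE -[RHS]card_ord -cardsT; apply: eq_card => x; rewrite !inE.
by rewrite -[RHS](@card_ord_lt (Zp_trunc t).+2) ?tE //.
Qed.

Lemma card_trunc_set : #|trunc_set| = 4 * t + h + e.
Proof.
rewrite card_set_option card_set_pair inE addnC; congr (_ + _).
under eq_bigr => i _.
  under eq_finset => x do rewrite !inE /=.
  rewrite card_col; over.
rewrite (bigD1 None) //= addnC; congr (_ + _).
rewrite (eq_bigr (fun=> t)) => [|i /negPf-> //].
by rewrite sum_nat_const cardC1 card_option card_ord.
Qed.

Lemma card_trunc_line_inr i :
  #|trunc_line (inr i)| = (if i == None then h else t) + e.
Proof.
rewrite card_set_option card_set_pair inE andbT addnC; congr (_ + _).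
rewrite (bigD1 i) //= big1 ?addn0 => [|j nji].
  by rewrite -card_col; apply: eq_card => x; rewrite !inE /= eqxx andbT.
by apply: eq_card0 => x; rewrite !inE /= (negPf nji) andbF.
Qed.

Lemma card_trunc_line_inl c :
  #|trunc_line (inl c)| = 4 + (td_val (None : option 'I_4) c < h).
Proof.
rewrite card_set_option card_set_pair inE andbF.
rewrite add0n (bigD1 None) //= addnC; congr (_ + _).
  rewrite (eq_bigr (fun=> 1)) => [|i /negPf ni].
    by rewrite sum_nat_const cardC1 card_option card_ord.
  by rewrite -[RHS](cards1 (td_val i c)); apply: eq_card => x; rewrite !inE /= ni.
case: ltnP => [lt_h|le_h].
  apply: etrans (cards1 (td_val (None : option 'I_4) c)); apply: eq_card => x; rewrite !inE /=.
  by case: eqP => [->|]; rewrite ?lt_h ?andbF.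
apply: eq_card0 => x; rewrite !inE /=.
by case: eqP => [->|]; rewrite ?andbF // ltnNge le_h.
Qed.

Lemma trunc_cov z1 z2 : ne_in trunc_set z1 z2 ->
  exists j, (z1 \in trunc_line j) && (z2 \in trunc_line j).
Proof.
case/and3P; rewrite !inE => A1 A2.
case: z1 A1 => [[i x]|] A1; case: z2 A2 => [[j y]|] A2 n12 //.
- have [eij|nij] := eqVneq i j.
    by exists (inr i); rewrite !inE A1 A2 /= eij eqxx.
  have [c [xE yE]] := td_val_ex t_gt1 cop x y nij.
  by exists (inl c); rewrite !inE A1 A2 /= xE yE !eqxx.
- by exists (inr i); rewrite !inE A1 A2 /= eqxx.
by exists (inr j); rewrite !inE A1 A2 /= eqxx.
Qed.

Lemma trunc_uniq j1 j2 z1 z2 :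
  z1 \in trunc_line j1 -> z2 \in trunc_line j1 ->
  z1 \in trunc_line j2 -> z2 \in trunc_line j2 ->
  z1 != z2 -> trunc_line j1 = trunc_line j2.
Proof.
rewrite !inE => /andP[_ P11] /andP[_ P21] /andP[_ P12] /andP[_ P22] n12.
have mixed c i0 z z' :
    match z with Some (i, x) => x == td_val i c | None => false end ->
    match z' with Some (i, x) => x == td_val i c | None => false end ->
    match z with Some (i, _) => i == i0 | None => true end ->
    match z' with Some (i, _) => i == i0 | None => true end -> z = z' :> point.
  case: z => [[i x]|] //; case: z' => [[j y]|] //.
  by move=> /eqP-> /eqP-> /eqP-> /eqP->.
case: j1 j2 P11 P21 P12 P22 => [c|i] [c'|i'] P11 P21 P12 P22.
- congr (trunc_line (inl _)).
  case: z1 z2 P11 P21 P12 P22 n12 => [[i x]|] [[j y]|] //.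
  move=> /eqP xE /eqP yE /eqP xE' /eqP yE' n12.
  apply: (td_val_inj t_gt1 cop (i := i) (j := j)); rewrite -?xE -?yE //.
  by apply: contraNneq n12 => eij; rewrite xE yE eij.
- by case/eqP: n12; apply: mixed P11 P21 P12 P22.
- by case/eqP: n12; apply: mixed P12 P22 P11 P21.
congr (trunc_line (inr _)).
case: z1 z2 P11 P21 P12 P22 n12 => [[i1 x]|] [[j1 y]|] //.
- by move=> /eqP<- _ /eqP<-.
- by move=> /eqP<- _ /eqP<-.
by move=> _ /eqP<- _ /eqP<-.
Qed.

Lemma gdd3_truncation : gdd3 5 -> gdd3 (t + e) -> gdd3 (h + e) ->
  gdd3 (4 * t + h + e).
Proof.
move=> g5 gt gh; rewrite -card_trunc_set.
have [| | | |L linL LE] := @linear_of_family _ (ne_in trunc_set) _ trunc_line.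
- by move=> p q /and3P[].
- exact: trunc_cov.
- move=> j p q pj qj npq; rewrite /ne_in /= !inE npq andbT.
  by move: pj qj; rewrite !inE => /andP[-> _] /andP[-> _].
- exact: trunc_uniq.
apply: pbd_closure linL _ => x y /LE[j -> _].
case: j => [c|i]; last by rewrite card_trunc_line_inr; case: eqP.
by rewrite card_trunc_line_inl; case: ltnP => _; [exact: g5|exact: gdd3_4].
Qed.

End TruncatedTransversalDesign.

(** * Difference families *)

Lemma uniq_map_inj (T1 T2 : eqType) (f : T1 -> T2) (s : seq T1) :
  uniq (map f s) -> {in s &, injective f}.
Proof.
elim: s => //= x s IHs /andP[fx Us] y z; rewrite !inE.
move=> /predU1P[->|ys] /predU1P[->|zs] // fE; last exact: IHs fE.
  by case/negP: fx; rewrite fE map_f.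
by case/negP: fx; rewrite -fE map_f.
Qed.

Section DifferenceFamily.
Variables (H : finZmodType) (e : bool) (bs : seq (seq (option H * 'Z_3))).
Local Open Scope ring_scope.
Let point : finType := (option H * 'Z_3)%type.

(** Points are pairs [(x, i)] with [x] in [H] or at infinity, and [i] modulo 3; the
group of [(x, i)] is that of index [x].  The group H x Z/3 acts by translations,
which on the points at infinity change the second coordinate only. *)
Definition translate (g : H * 'Z_3) (p : point) : point :=
  (omap (+%R^~ g.1) p.1, p.2 + g.2).

(** The orbit of the pair [(p, q)] under translations, when [q] is not at infinity:
a difference, whose first coordinate is [None] if [p] is at infinity.  The
value is meaningless when [q] is at infinity. *)
Definition pair_diff (p q : point) : option H * 'Z_3 :=
  (if q.1 is Some y then omap (fun x => y - x) p.1 else None, q.2 - p.2).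

(** The pairs of distinct points [p], [q] of a base block, with [q] not at infinity,
each with its block. *)
Definition base_pairs : seq (seq point * point * point) :=
  flatten [seq [seq (B, p, q) | p <- B, q <- [seq q <- B | (q != p) && isSome q.1]]
          | B <- bs].

Definition base_diffs := [seq pair_diff x.1.2 x.2 | x <- base_pairs].

(** The base blocks have four points in distinct groups, use infinity only when [e]
holds, and have pairwise distinct differences.  As many differences as possible
occur, so every admissible difference occurs exactly once (mem_base_diffs). *)
Definition difference_family :=
  [&& all (fun B => [&& size B == 4%N, uniq [seq p.1 | p <- B] &
                       all (fun p => e || isSome p.1) B]) bs,
      size base_diffs == (3 * (#|H|.-1 + e))%N & uniq base_diffs].

Lemma base_pairsP B p q :
  reflect [/\ B \in bs, p \in B, q \in B, q != p & q.1] ((B, p, q) \in base_pairs).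
Proof.
apply: (iffP flatten_mapP) => [[B' B's /allpairsPdep[p' [q' []]]]|[Bs pB qB nqp q1]].
  by move=> pB; rewrite mem_filter => /andP[/andP[? ?] ?] [-> -> ->].
exists B => //; apply/allpairsPdep; exists p, q; rewrite /= mem_filter.
by rewrite nqp q1.
Qed.

Hypothesis dfB : difference_family.

Let blockP B : B \in bs -> [/\ size B = 4%N, uniq [seq p.1 | p <- B] &
  {in B, forall p, e || isSome p.1}].
Proof.
by case/and3P: dfB => /allP/(_ B) + _ _ => /[apply] /and3P[/eqP ? ? /allP].
Qed.

Let block_inj B p q : B \in bs -> p \in B -> q \in B -> p.1 = q.1 -> p = q.
Proof. by move=> /blockP[_ U _] pB qB; apply: (uniq_map_inj U). Qed.

Let A := [set x : option H | e || isSome x].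

Lemma card_points : #|A| = (#|H| + e)%N.
Proof.
rewrite (cardsD1 None) inE orbF addnC; congr (_ + _)%N.
rewrite -[RHS]cardsT -[RHS](card_imset _ (@Some_inj _)); apply: eq_card => -[x|].
  by rewrite mem_imset ?inE ?orbT //; apply: Some_inj.
by rewrite !inE; apply/esym/imsetP => -[].
Qed.

Lemma mem_base_diffs d : d \in base_diffs = (d.1 != Some 0) && (e || isSome d.1).
Proof.
case/and3P: (dfB) => _ /eqP sizeD uniqD.
have <- : (d \in enum [set d : point | d.1 \in A :\ Some 0]) =
    (d.1 != Some 0) && (e || isSome d.1) by rewrite mem_enum !inE.
apply: (uniq_min_size uniqD _ _).2.
  move=> _ /mapP[[[B p] q] /base_pairsP[Bs pB qB nqp q1] ->] /=.
  rewrite mem_enum !inE /pair_diff /=; case: q q1 qB nqp => [[y|] j] //= _ qB nqp.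
  case: p pB nqp => [[x|] i] pB nqp //=; rewrite ?orbT ?andbT.
    apply: contraNneq nqp => -[/eqP]; rewrite subr_eq0 => /eqP yx.
    by apply/eqP; apply: block_inj Bs qB pB _; rewrite yx.
  by have [_ _ /(_ _ pB)] := blockP Bs.
rewrite sizeD -cardE.
have -> : [set d : point | d.1 \in A :\ Some 0] = setX (A :\ Some 0) [set: 'Z_3].
  by apply/setP => x; rewrite !inE andbT.
have := cardsD1 (Some 0) A; rewrite card_points inE orbT.
have H_gt0 : (0 < #|H|)%N by apply/card_gt0P; exists 0.
rewrite cardsX cardsT card_ord (_ : (Zp_trunc 3).+2 = 3%N) // add1n.
case: #|H| H_gt0 => // n _; rewrite addSn => -[->]; rewrite mulnC.
exact: leqnn.
Qed.

Lemma pair_diff_translate g p q :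
  isSome q.1 -> pair_diff (translate g p) (translate g q) = pair_diff p q.
Proof.
case: p q => [[x|] i] [[y|] j] //= _; rewrite /pair_diff /=; congr pair.
- by congr Some; rewrite opprD addrACA subrr addr0.
- by rewrite opprD addrACA subrr addr0.
by rewrite opprD addrACA subrr addr0.
Qed.

Lemma pair_diff_eq p q p0 q0 : isSome q.1 -> isSome q0.1 ->
  pair_diff p0 q0 = pair_diff p q ->
  exists g, translate g p0 = p /\ translate g q0 = q.
Proof.
have key (V : zmodType) (x y x0 y0 : V) : y0 - x0 = y - x -> x0 + (y - y0) = x.
  move=> E; rewrite addrCA -opprB E opprB addrC subrK //.
case: q q0 => [[y|] j] [[y0|] j0] // _ _ /eqP; rewrite xpair_eqE => /andP[/eqP E1 /eqP E2].
exists (y - y0, j - j0); rewrite /translate /= !(addrC _ (_ - _)) !subrK; split=> //.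
case: p p0 E1 E2 => [[x|] i] [[x0|] i0] //= E1 E2;
  rewrite ![_ - _ + _]addrC (key _ _ _ _ _ E2) //.
by case: E1 => /key->.
Qed.

Definition translate_block (j : seq_sub bs * (H * 'Z_3)) : {set point} :=
  [set translate j.2 p | p in ssval j.1].

Lemma translate_inj g : injective (translate g).
Proof.
move=> [x i] [y j] /eqP; rewrite xpair_eqE => /andP[/eqP E /eqP/addIr /= ->].
by case: x y E => [x|] [y|] //= [/addIr->].
Qed.

(** The translates of the base blocks are the blocks of a group divisible design:
each orbit of collinear pairs is met exactly once by the base blocks, and a
pair with a finite second point determines the translation. *)
Lemma gdd3_difference_family : gdd3 (#|H| + e).
Proof.
rewrite -card_points; apply: (gdd3_card _).1.
have Rneq p q : gdd_rel A p q -> p != q.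
  by case/and3P=> _ _; apply: contraNneq => ->.
apply: (@steiner4_of_family _ _ _ translate_block) => //.
(* Points at infinity form one group, so one of two collinear points is finite. *)
- move=> p q; wlog q1 : p q / isSome q.1 => [wl|].
    case: (boolP (isSome q.1)) => [|q1]; first exact: wl.
    case: p q q1 => [[x|] i] [[y|] j] // _ /and3P[/= pA qA npq].
      have [||k kP] := wl (None, j) (Some x, i) => //; first by apply/and3P.
      by exists k; rewrite andbC.
    by case/eqP: npq.
  case/and3P => pA qA npq.
  have /mapP[[[B p0] q0] /base_pairsP[Bs pB qB nqp q01] /esym E] :
      pair_diff p q \in base_diffs.
    rewrite mem_base_diffs /pair_diff.
    case: q q1 qA npq => [[y|] j] //= _ _ npq.
    case: p pA npq => [[x|] i] /=; rewrite inE ?orbF => -> npq; rewrite ?andbT ?orbT //.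
    by apply: contraNneq npq => -[/eqP]; rewrite subr_eq0 => /eqP->.
  have [g [<- <-]] := pair_diff_eq q1 q01 E.
  exists (SeqSub Bs, g); rewrite /translate_block /=.
  by rewrite !mem_imset //; try exact: translate_inj; rewrite pB qB.
- move=> [B g] p q /imsetP[p0 /= p0B ->] /imsetP[q0 q0B ->] npq.
  have Bs := ssvalP B; have [sB uB eB] := blockP Bs.
  have inA r : r \in ssval B -> (translate g r).1 \in A.
    by move=> /eB; rewrite inE; case: r => -[].
  split.
    apply/and3P; split; [exact: inA|exact: inA|].
    apply: contraNneq npq => E; apply/eqP; congr (translate g _).
    apply: block_inj Bs _ _ _ => //.
    by case: p0 q0 {p0B q0B} E => [[x|] i] [[y|] j] //= [/addIr->].
  rewrite /translate_block /= card_imset; last exact: translate_inj.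
  by rewrite -sB; apply/card_uniqP; apply: map_uniq uB.
move=> [B g] [B' g'] p q; wlog q1 : p q / isSome q.1 => [wl|].
  case: (boolP (isSome q.1)) => [|q1]; first exact: wl.
  case: (boolP (isSome p.1)) => [p1 Hp Hq Hp' Hq' npq|p1].
    by apply: (wl q p) => //; rewrite eq_sym.
  move=> /imsetP[p0 /= p0B pE] /imsetP[q0 q0B qE] _ _ /eqP[].
  rewrite pE qE; congr translate; apply: (block_inj (ssvalP B)) => //.
  by move: p1 q1; rewrite pE qE; case: p0 q0 {p0B q0B pE qE}=> [[x|] i] [[y|] j].
move=> /imsetP[p0 /= p0B pE] /imsetP[q0 q0B qE].
move=> /imsetP[p0' /= p0B' pE'] /imsetP[q0' q0B' qE'] npq.
have q01 : isSome q0.1 by move: q1; rewrite qE; case: q0 {q0B qE} => -[].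
have q01' : isSome q0'.1 by move: q1; rewrite qE'; case: q0' {q0B' qE'} => -[].
have in1 : (ssval B, p0, q0) \in base_pairs.
  apply/base_pairsP; split=> //; first exact: ssvalP.
  by apply: contraNneq npq => E; rewrite pE qE E.
have in2 : (ssval B', p0', q0') \in base_pairs.
  apply/base_pairsP; split=> //; first exact: ssvalP.
  by apply: contraNneq npq => E; rewrite pE' qE' E.
have uD : uniq base_diffs by case/and3P: dfB.
have [] : (ssval B, p0, q0) = (ssval B', p0', q0').
  apply: (uniq_map_inj uD) => //=.
  by rewrite -(pair_diff_translate g) // -pE -qE pE' qE' pair_diff_translate.
rewrite /translate_block /= => -> _ qq; congr imset.
suff -> : g = g' by [].
move: qE'; rewrite qE -qq; case: q0 q01 {q0B qE in1 qq} => [[y|] j] //= _ /eqP.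
rewrite xpair_eqE => /andP[/eqP[/addrI E1] /eqP/addrI E2].
by clear -E1 E2; case: g g' E1 E2 => [g k] [g' k'] /= -> ->.
Qed.
End DifferenceFamily.

(** * Group divisible designs for all admissible numbers of groups *)

Definition cyclic_block m (s : seq (nat * nat)) : seq (option 'Z_m * 'Z_3) :=
  [seq (Some (inZp p.1), inZp p.2) | p <- s].

(** Families over Z/m x Z/3 without points at infinity. *)
Lemma gdd3_cyclic m (ss : seq (seq (nat * nat))) : 1 < m ->
  difference_family false [seq cyclic_block m s | s <- ss] -> gdd3 m.
Proof.
move=> m_gt1 /gdd3_difference_family.
by rewrite card_ord addn0 Zp_cast.
Qed.

(** Families over Z/m x Z/3 in which the first base block, [s] completed by a point
at infinity, is the only one to use infinity. *)
Lemma gdd3_one_rotational m (s : seq (nat * nat)) (ss : seq (seq (nat * nat))) :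
  1 < m ->
  difference_family true
    (((None, 0%R) :: cyclic_block m s) :: [seq cyclic_block m s | s <- ss]) ->
  gdd3 m.+1.
Proof.
move=> m_gt1 /gdd3_difference_family.
by rewrite card_ord Zp_cast // addn1.
Qed.

Lemma gdd3_5 : gdd3 5.
Proof.
apply: (@gdd3_cyclic 5 [::
    [:: (0, 0); (3, 1); (4, 0); (1, 1)]]) => //.
by rewrite /difference_family card_ord; vm_compute.
Qed.

Lemma gdd3_8 : gdd3 8.
Proof.
apply: (@gdd3_one_rotational 7 [:: (5, 0); (3, 1); (6, 2)] [::
    [:: (0, 0); (5, 0); (3, 2); (4, 0)]]) => //.
by rewrite /difference_family card_ord; vm_compute.
Qed.

Lemma gdd3_12 : gdd3 12.
Proof.
apply: (@gdd3_one_rotational 11 [:: (3, 0); (1, 1); (7, 2)] [::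
    [:: (0, 0); (10, 1); (7, 0); (2, 0)];
    [:: (0, 0); (3, 0); (9, 2); (10, 2)]]) => //.
by rewrite /difference_family card_ord; vm_compute.
Qed.

Lemma gdd3_13 : gdd3 13.
Proof.
apply: (@gdd3_cyclic 13 [::
    [:: (0, 0); (6, 0); (5, 1); (1, 1)];
    [:: (0, 0); (5, 0); (2, 1); (3, 1)];
    [:: (0, 0); (2, 0); (6, 1); (9, 1)]]) => //.
by rewrite /difference_family card_ord; vm_compute.
Qed.

Lemma gdd3_16 : gdd3 16.
Proof.
apply: (@gdd3_one_rotational 15 [:: (3, 0); (13, 1); (5, 2)] [::
    [:: (0, 0); (7, 2); (4, 0); (6, 0)];
    [:: (0, 0); (4, 2); (7, 0); (10, 0)];
    [:: (0, 0); (6, 2); (4, 1); (5, 1)]]) => //.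
by rewrite /difference_family card_ord; vm_compute.
Qed.

Lemma gdd3_17 : gdd3 17.
Proof.
apply: (@gdd3_cyclic 17 [::
    [:: (0, 0); (1, 1); (10, 1); (11, 0)];
    [:: (0, 0); (4, 1); (6, 1); (10, 0)];
    [:: (0, 0); (13, 0); (8, 1); (5, 1)];
    [:: (0, 0); (1, 0); (15, 1); (3, 1)]]) => //.
by rewrite /difference_family card_ord; vm_compute.
Qed.

Lemma gdd3_28 : gdd3 28.
Proof.
apply: (@gdd3_one_rotational 27 [:: (7, 0); (1, 1); (11, 2)] [::
    [:: (0, 0); (16, 2); (8, 0); (20, 2)];
    [:: (0, 0); (25, 1); (17, 0); (22, 2)];
    [:: (0, 0); (16, 1); (3, 0); (2, 1)];
    [:: (0, 0); (26, 2); (17, 1); (12, 1)];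
    [:: (0, 0); (7, 2); (4, 1); (25, 0)];
    [:: (0, 0); (16, 0); (7, 0); (1, 0)]]) => //.
by rewrite /difference_family card_ord; vm_compute.
Qed.

Lemma gdd3_37 : gdd3 37.
Proof.
apply: (@gdd3_cyclic 37 [::
    [:: (0, 0); (28, 2); (4, 0); (22, 0)];
    [:: (0, 0); (21, 2); (3, 0); (35, 0)];
    [:: (0, 0); (25, 2); (30, 0); (17, 0)];
    [:: (0, 0); (20, 1); (27, 0); (16, 2)];
    [:: (0, 0); (15, 1); (11, 0); (12, 2)];
    [:: (0, 0); (2, 1); (36, 0); (9, 2)];
    [:: (0, 0); (1, 1); (16, 0); (24, 1)];
    [:: (0, 0); (10, 1); (12, 0); (18, 1)];
    [:: (0, 0); (26, 1); (9, 0); (32, 1)]]) => //.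
by rewrite /difference_family card_ord; vm_compute.
Qed.

Lemma gdd3_40 : gdd3 40.
Proof.
apply: (@gdd3_one_rotational 39 [:: (28, 0); (4, 1); (24, 2)] [::
    [:: (0, 0); (31, 2); (28, 1); (14, 0)];
    [:: (0, 0); (22, 0); (30, 0); (18, 1)];
    [:: (0, 0); (38, 2); (20, 0); (26, 2)];
    [:: (0, 0); (15, 2); (25, 1); (38, 1)];
    [:: (0, 0); (7, 1); (33, 2); (10, 1)];
    [:: (0, 0); (3, 2); (11, 1); (12, 1)];
    [:: (0, 0); (4, 0); (2, 2); (34, 2)];
    [:: (0, 0); (22, 2); (15, 0); (20, 2)];
    [:: (0, 0); (34, 0); (28, 0); (18, 0)]]) => //.
by rewrite /difference_family card_ord; vm_compute.
Qed.

Lemma gdd3_41 : gdd3 41.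
Proof.
apply: (@gdd3_cyclic 41 [::
    [:: (0, 0); (34, 0); (9, 1); (23, 1)];
    [:: (0, 0); (12, 0); (8, 1); (25, 1)];
    [:: (0, 0); (38, 0); (39, 1); (4, 1)];
    [:: (0, 0); (11, 0); (21, 1); (40, 1)];
    [:: (0, 0); (28, 0); (5, 1); (31, 1)];
    [:: (0, 0); (15, 2); (10, 0); (17, 2)];
    [:: (0, 0); (27, 2); (18, 0); (6, 2)];
    [:: (0, 0); (24, 2); (16, 0); (19, 2)];
    [:: (0, 0); (35, 2); (37, 0); (26, 2)];
    [:: (0, 0); (22, 2); (1, 0); (14, 2)]]) => //.
by rewrite /difference_family card_ord; vm_compute.
Qed.

Lemma gdd3_44 : gdd3 44.
Proof.
apply: (@gdd3_one_rotational 43 [:: (9, 0); (0, 1); (32, 2)] [::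
    [:: (0, 0); (14, 2); (3, 1); (42, 0)];
    [:: (0, 0); (41, 2); (18, 1); (37, 0)];
    [:: (0, 0); (31, 2); (22, 1); (7, 0)];
    [:: (0, 0); (8, 0); (21, 0); (3, 0)];
    [:: (0, 0); (37, 2); (19, 0); (2, 0)];
    [:: (0, 0); (7, 2); (28, 0); (12, 0)];
    [:: (0, 0); (42, 2); (39, 0); (29, 0)];
    [:: (0, 0); (9, 0); (35, 1); (2, 2)];
    [:: (0, 0); (11, 0); (38, 1); (12, 2)];
    [:: (0, 0); (23, 0); (13, 1); (29, 2)]]) => //.
by rewrite /difference_family card_ord; vm_compute.
Qed.

(* Makes a product of finite abelian groups a finite abelian group. *)
HB.saturate prod.

(** Base blocks over the elementary abelian group of order 27. *)
Lemma gdd3_9 : gdd3 9.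
Proof.
pose v x y i : option ('Z_3 * 'Z_3) * 'Z_3 := (Some (inZp x, inZp y), inZp i).
have := @gdd3_difference_family ('Z_3 * 'Z_3)%type false
  [:: [:: v 0 0 0; v 2 0 2; v 0 1 0; v 2 1 0];
      [:: v 0 0 0; v 1 2 2; v 1 1 0; v 2 0 1]].
rewrite /difference_family card_prod !card_ord; apply.
by vm_compute.
Qed.

(** Strong induction on [u], with u = 4 t + h + e, t coprime to 6 and e = 1 exactly
when t is 3 modulo 4; then t + e and h + e are again 0 or 1 modulo 4. *)
Lemma gdd3_exists u : u %% 4 < 2 -> gdd3 u.
Proof.
have [n] := ubnP u; elim: n u => // n IHn u lt_un u4.
have rec t h (e : bool) : u = 4 * t + h + e -> h <= t -> (t + e) %% 4 < 2 ->
    (t %% 6 == 1) || (t %% 6 == 5) -> 5 <= t -> gdd3 u.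
  move=> uE le_ht te4 t6 t5; rewrite uE; apply: gdd3_truncation => //.
  - lia.
  - rewrite (_ : 6 = 2 * 3) // coprimeMr !(coprime_sym t) coprime2n prime_coprime //.
    by lia.
  - exact: gdd3_5.
  - by apply: IHn; lia.
  - by apply: IHn; case: e uE te4; lia.
have [u45|u45] := leqP 45 u.
  (* From 45 on, except at 68 where t = 17 and h = 0, there is always some t
     coprime to 6 with u/5 <= t < u/4. *)
  have [u68|nu68] := eqVneq u 68; first by apply: (rec 17 0 false).
  have rec' t : 4 * t < u <= 5 * t -> (t %% 6 == 1) || (t %% 6 == 5) -> 5 <= t -> gdd3 u.
    move=> ut t6 t5; pose e := t %% 4 == 3.
    by apply: (rec t (u - 4 * t - e) e); rewrite // /e; lia.
  have [q [r [uE r24]]] : exists q r, u = 24 * q + r + 1 /\ r < 24.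
    by exists ((u - 1) %/ 24), ((u - 1) %% 24); lia.
  have [r4|r4] := ltnP r 4; first by apply: (rec' (6 * q - 1)); lia.
  by have [r20|r20] := ltnP r 20; [apply: (rec' (6 * q + 1))|apply: (rec' (6 * q + 5))]; lia.
have [|] := boolP (u \in [:: 0; 1; 4; 5; 8; 9; 12; 13; 16; 17; 28; 37; 40; 41; 44]).
  rewrite !inE; do ?[case/predU1P => [->|]].
  all: try by [apply: gdd3_lt2 | exact: gdd3_4 | exact: gdd3_5 | exact: gdd3_8
    | exact: gdd3_9 | exact: gdd3_12 | exact: gdd3_13 | exact: gdd3_16 | exact: gdd3_17
    | exact: gdd3_28 | exact: gdd3_37 | exact: gdd3_40 | exact: gdd3_41].
  by move/eqP->; exact: gdd3_44.
move=> nbase; have : u \in [:: 20; 21; 24; 25; 29; 32; 33; 36].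
  move: nbase u4 u45; rewrite !inE; clear; lia.
rewrite !inE; do ?[case/predU1P => [uE|]].
- by apply: (rec 5 0 false).
- by apply: (rec 5 1 false).
- by apply: (rec 5 4 false).
- by apply: (rec 5 5 false).
- by apply: (rec 7 0 true).
- by apply: (rec 7 3 true).
- by apply: (rec 7 4 true).
by move/eqP=> uE; apply: (rec 7 7 true).
Qed.

(** * Steiner systems *)

(** The lines are the blocks of the design and the groups completed by one new
point [None]. *)
Lemma steiner4_of_gdd3 u : gdd3 u ->
  steiner4 [rel x y : 'I_(3 * u).+1 | x != y].
Proof.
case=> L linL L4.
pose point : finType := option ('I_u * 'I_3).
have cardP : #|point| = (3 * u).+1.
  by rewrite card_option card_prod !card_ord mulnC.
pose f (i : 'I_(3 * u).+1) : point := enum_val (cast_ord (esym cardP) i).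
have f_inj : injective f by move=> i j /enum_val_inj/cast_ord_inj.
have fP y : y \in codom f.
  by apply: (inj_card_onto f_inj); rewrite cardP card_ord.
apply: (steiner4_pull (R := [rel x y : point | x != y]) f_inj) => //.
  by move=> x y /=; rewrite (inj_eq f_inj).
pose b (j : 'I_u + ('I_u * 'I_3) * ('I_u * 'I_3)) : {set point} :=
  match j with
  | inl x => [set z | if z is Some p then p.1 == x else true]
  | inr (p, q) => if p.1 != q.1 then Some @: L p q else set0
  end.
have Rb (p q : 'I_u * 'I_3) : p.1 != q.1 -> gdd_rel [set: 'I_u] p q.
  by move=> npq; rewrite /gdd_rel /ne_in /= !inE.
have inbr j z : z \in b (inr j) ->
    j.1.1 != j.2.1 /\ exists2 r, r \in L j.1 j.2 & z = Some r.
  by case: j => p q /=; case: ifP => [_ /imsetP//|_]; rewrite inE.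
apply: (@steiner4_of_family _ _ _ b) => //.
- move=> [p|] [q|] //= npq.
  + have [epq|npq1] := eqVneq p.1 q.1.
      by exists (inl q.1); rewrite /= !inE epq !eqxx.
    exists (inr (p, q)); rewrite /= npq1 !mem_imset; try exact: Some_inj.
    by have [-> ->] := linL _ _ (Rb _ _ npq1).
  + by exists (inl p.1); rewrite /= !inE eqxx.
  by exists (inl q.1); rewrite /= !inE eqxx.
- move=> [x|j] y z yb zb nyz; split=> //.
    rewrite card_set_option inE card_set_pair (bigD1 x) //= big1 ?addn0 => [|i nix].
      rewrite (eq_card (B := 'I_3)) ?card_ord // => i.
      by rewrite !inE eqxx.
    by apply: eq_card0 => j; rewrite !inE (negPf nix).
  have [nj _] := inbr _ _ yb; case: j nj {yb zb} => p q /= nj.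
  by rewrite nj card_imset ?L4 ?Rb //; apply: Some_inj.
have mixed i j y z : y \in b (inl i) -> z \in b (inl i) ->
    y \in b (inr j) -> z \in b (inr j) -> y = z.
  move=> yi zi yj zj; have [nj [p pL yE]] := inbr _ _ yj; have [_ [q qL zE]] := inbr _ _ zj.
  move: yi zi; rewrite yE zE !inE => /eqP pi /eqP qi.
  have [->//|npq] := eqVneq p q.
  have [_ _ /(_ _ _ pL qL npq)[/and3P[_ _]]] := linL _ _ (Rb _ _ nj).
  by rewrite pi qi eqxx.
move=> [i|i] [j|j] y z yi zi yj zj nyz.
- congr (b (inl _)); case: y z yi zi yj zj nyz => [y|] [z|] //; rewrite !inE.
  + by move=> /eqP<- _ /eqP<-.
  + by move=> /eqP<- _ /eqP<-.
  by move=> _ /eqP<- _ /eqP<-.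
- by case/eqP: nyz; apply: mixed yi zi yj zj.
- by case/eqP: nyz; apply: mixed yj zj yi zi.
have [ni [p pi yE]] := inbr _ _ yi; have [_ [q qi zE]] := inbr _ _ zi.
have [nj [p' pj yE']] := inbr _ _ yj; have [_ [q' qj zE']] := inbr _ _ zj.
move: yE' zE' nyz; rewrite yE zE => -[pp] [qq]; rewrite -pp -qq in pj qj.
rewrite (inj_eq (@Some_inj _)) => npq.
have [_ _ /(_ _ _ pi qi npq)[_ Ei]] := linL _ _ (Rb _ _ ni).
have [_ _ /(_ _ _ pj qj npq)[_ Ej]] := linL _ _ (Rb _ _ nj).
case: i j ni nj {yi zi yj zj pi qi pj qj} Ei Ej => [i1 i2] [j1 j2] /= -> -> <- <-.
by [].
Qed.

(** * Colorings from Steiner systems *)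

Definition mk_edge n (e : {set 'I_n}) (e2 : #|e| == 2) : edge n := exist _ e e2.

Lemma card_edges_in n (S : {set 'I_n}) :
  #|[set e : edge n | val e \subset S]| = 'C(#|S|, 2).
Proof.
rewrite -cards_draws -(card_imset _ val_inj); apply: eq_card => e.
rewrite [in RHS]inE; apply/imsetP/andP => [[d]|[eS e2]].
  by rewrite inE => dS ->; rewrite dS; case: d dS.
by exists (mk_edge e2); rewrite ?inE.
Qed.

Lemma card_edge_val n (e : edge n) : #|val e| = 2.
Proof. by case: e => e /= /eqP. Qed.

(** A coloring with values in any finite type uses as palette a set containing all
its values. *)
Lemma pq_colorable_fun n p q (U : finType) (D : {set U}) (f : edge n -> U) :
    (forall e, f e \in D) ->
    (forall S : {set 'I_n}, #|S| = p ->
       q <= #|[set f e | e : edge n & val e \subset S]|) ->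
  pq_colorable n p q #|D|.
Proof.
move=> fD fq; apply/existsP; exists [ffun e => enum_rank_in (fD e) (f e)].
apply/forallP => S; apply/implyP => /eqP/fq/leq_trans; apply.
rewrite -(card_imset _ (@enum_val_inj _ (mem D))); apply: subset_leq_card.
apply/subsetP => _ /imsetP[e eS ->]; apply/imsetP.
exists (enum_rank_in (fD e) (f e)); last by rewrite enum_rankK_in.
by apply/imsetP; exists e; rewrite ?ffunE.
Qed.

Lemma pq_colorable_leq m n p q k : m <= n ->
  pq_colorable n p q k -> pq_colorable m p q k.
Proof.
move=> le_mn /existsP[c /forallP cP].
pose w := widen_ord le_mn.
have w_inj : injective w by move=> i j /(congr1 val) /= /val_inj.
have we (e : edge m) : #|w @: val e| == 2 by rewrite card_imset // card_edge_val.
apply/existsP; exists [ffun e : edge m => c (mk_edge (we e))].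
apply/forallP => S; apply/implyP => /eqP cardS.
have := cP (w @: S); rewrite card_imset // cardS eqxx /= => /leq_trans; apply.
apply: subset_leq_card; apply/subsetP => _ /imsetP[e eS ->]; rewrite inE in eS.
have d2 : #|w @^-1: val e| == 2.
  apply/eqP; rewrite -[RHS](card_edge_val e) -(card_imset (w @^-1: val e) w_inj).
  apply: eq_card => x.
  apply/imsetP/idP => [[y]|xe]; first by rewrite inE => ye ->.
  have /imsetP[y yS xE] := subsetP eS x xe.
  by exists y; rewrite // inE -xE.
apply/imsetP; exists (mk_edge d2).
  by rewrite inE; apply/subsetP => y; rewrite inE => /(subsetP eS); rewrite mem_imset.
rewrite ffunE; congr (c _); apply: val_inj => /=.
apply/setP => x; apply/idP/imsetP => [xe|[y]]; last by rewrite inE => ye ->.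
by have /imsetP[y yS xE] := subsetP eS x xe; exists y; rewrite // inE -xE.
Qed.

(** One color is saved for each block of the Steiner system. *)
Lemma colorable_of_steiner4 n : 1 < n -> steiner4 [rel x y : 'I_n | x != y] ->
  exists2 k, pq_colorable n 6 14 k & 6 * k <= 5 * 'C(n, 2).
Proof.
move=> n_gt1 [L linL L4].
pose B := [set b : {set 'I_n} | [exists p, (p.1 != p.2) && (b == L p.1 p.2)]].
have BP b : b \in B -> exists x y, x != y /\ b = L x y.
  by rewrite inE => /existsP[[x y] /andP[/= nxy /eqP]]; exists x, y.
have LB x y : x != y -> L x y \in B.
  by move=> nxy; rewrite inE; apply/existsP; exists (x, y); rewrite /= nxy eqxx.
have B4 b : b \in B -> #|b| = 4 by move=> /BP[x [y [nxy ->]]]; rewrite L4.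
have Buniq b b' : b \in B -> b' \in B -> 1 < #|b :&: b'| -> b = b'.
  move=> /BP[x [y [nxy ->]]] /BP[x' [y' [nxy' ->]]] /card_gt1P[r [s []]].
  rewrite !inE => /andP[r1 r2] /andP[s1 s2] nrs.
  have [_ _ /(_ _ _ r1 s1 nrs)[_ <-]] := linL _ _ nxy.
  by have [_ _ /(_ _ _ r2 s2 nrs)[_ <-]] := linL _ _ nxy'.
have Bedge b b' (e : edge n) : b \in B -> b' \in B ->
    val e \subset b -> val e \subset b' -> b = b'.
  move=> bB bB' eb eb'; apply: Buniq => //.
  by rewrite -(card_edge_val e) subset_leq_card // subsetI eb.
have /card_gt0P[e0 _] : 0 < #|edge n| by rewrite card_edge bin_gt0.
(* [m b] is a perfect matching of the block [b]. *)
have /fin_all_exists[m mP] (b : {set 'I_n}) : exists m : edge n * edge n,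
    b \in B -> m.1 != m.2 /\ val m.1 :|: val m.2 = b.
  have [/[dup] bB /BP[x [y [nxy bE]]]|nb] := boolP (b \in B); last by exists (e0, e0).
  have [xb yb _] := linL _ _ nxy; rewrite -bE in xb yb.
  have c1 : #|[set x; y]| == 2 by rewrite cards2 nxy.
  have sb : [set x; y] \subset b by rewrite subUset !sub1set xb yb.
  have c2 : #|b :\: [set x; y]| == 2 by rewrite cardsDS // B4 // (eqP c1).
  exists (mk_edge c1, mk_edge c2) => _ /=; split.
    by apply/eqP => -[/setP/(_ x)]; rewrite !inE eqxx.
  by rewrite setDE setUIr setUCr setIT (setUidPr sb).
have mL b : b \in B -> val (m b).1 \subset b by move=> /mP[_ {2}<-]; apply: subsetUl.
have mR b : b \in B -> val (m b).2 \subset b by move=> /mP[_ {2}<-]; apply: subsetUr.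
pose M2 := [set (m b).2 | b in B].
(* Colors are edges: the second edge of each matching takes the color of the
   first one, and any other edge is its own color. *)
pose f e := if [pick b in B | e == (m b).2] is Some b then (m b).1 else e.
have f2 b : b \in B -> f (m b).2 = (m b).1.
  move=> bB; rewrite /f; case: pickP => [b' /andP[b'B /eqP E]|/(_ b)]; last by rewrite bB eqxx.
  by rewrite (Bedge b b' (m b).2 bB b'B) ?mR // E mR.
have f1 e : e \notin M2 -> f e = e.
  move=> eM; rewrite /f; case: pickP => // b /andP[bB /eqP E].
  by case/negP: eM; rewrite E; apply: imset_f.
have m12 b : b \in B -> (m b).1 \notin M2.
  move=> bB; apply/imsetP => -[b' b'B E]; have [/eqP[]] := mP b bB.
  by rewrite E; congr (m _).2; apply: (Bedge b' b (m b).1) => //; rewrite ?mL // E mR.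
have fM e : f e \in ~: M2.
  rewrite inE; have [/imsetP[b bB ->]|eM] := boolP (e \in M2); last by rewrite f1.
  by rewrite f2 // m12.
have cardM2 : #|M2| = #|B|.
  apply: card_in_imset => b b' bB b'B E.
  by apply: (Bedge b b' (m b).2) => //; rewrite ?mR // E mR.
exists #|~: M2|.
  apply: pq_colorable_fun fM _ => S cardS.
  pose ES := [set e : edge n | val e \subset S].
  (* Second edges of matchings in S; this coloring is injective on the others. *)
  pose D := [set (m b).2 | b in [set b in B | b \subset S]].
  have cardD : #|D| <= 1.
    apply: leq_trans (leq_imset_card _ _) _; apply/card_le1_eqP => b b'.
    move=> /setIdP[bB bS] /setIdP[b'B b'S]; apply: Buniq => //.
    have := subset_leq_card (_ : b' :|: b \subset S); rewrite subUset b'S bS.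
    by move/(_ isT); have := cardsUI b' b; rewrite cardS (B4 b) // (B4 b') //; lia.
  have f_inj : {in ES :\: D &, injective f}.
    have mixed e b : e \in ES -> e \notin M2 -> (m b).2 \in ES :\: D -> b \in B ->
        f e <> f (m b).2.
      move=> eS eM /setDP[bS /negP nD] bB; rewrite f1 // f2 // => E.
      apply: nD; apply: imset_f; apply/setIdP; split=> //; have [_ <-] := mP b bB.
      by rewrite subUset -E; move: eS bS; rewrite !inE => -> ->.
    move=> e e' eS eS'.
    have [/imsetP[b bB eE]|eM] := boolP (e \in M2);
      have [/imsetP[b' b'B eE']|eM'] := boolP (e' \in M2).
    - rewrite eE eE' !f2 // => E.
      by rewrite (Bedge b b' (m b).1) ?mL // E mL.
    - rewrite eE in eS *; move/esym/mixed => [] //; first by case/setDP: eS'.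
    - rewrite eE' in eS' *; move/mixed => [] //; first by case/setDP: eS.
    by rewrite !f1.
  have : f @: (ES :\: D) \subset [set f e | e : edge n & val e \subset S].
    by apply: imsetS; apply/subsetP => e /setDP[].
  move/subset_leq_card; rewrite card_in_imset //; apply: leq_trans.
  have := subset_leq_card (subsetIr ES D); rewrite cardsD card_edges_in cardS.
  rewrite (_ : 'C(6, 2) = 15) //; lia.
have: 'C(n, 2) <= #|B| * 6.
  rewrite -card_edge -sum_nat_const -sum1_card.
  apply: (@leq_trans (\sum_(e : edge n) \sum_(b in B | val e \subset b) 1)).
    apply: leq_sum => e _; have /cards2P[x [y [nxy eE]]] := valP e.
    rewrite (bigD1 (L x y)) //= LB //=.
    by rewrite eE subUset !sub1set; have [-> -> _] := linL _ _ nxy.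
  rewrite (exchange_big_dep (mem B)) /=; last by move=> ? ? _ /andP[].
  apply: leq_sum => b bB; rewrite sum1dep_card.
  rewrite (_ : 6 = 'C(4, 2)) // -(B4 _ bB) -card_edges_in.
  by apply/eq_leq/eq_card => e; rewrite [LHS]inE [RHS]inE bB.
by rewrite (cardsCs (~: M2)) setCK card_edge cardM2; lia.
Qed.

(** * The lower bound *)

Lemma superset_card (T : finType) (A : {set T}) p :
  #|A| <= p <= #|T| -> exists2 S : {set T}, A \subset S & #|S| = p.
Proof.
move=> /andP[]; elim: p => [|p IHp] leA leT.
  by exists A => //; apply/eqP; rewrite -leqn0.
have [/eqP|neqA] := eqVneq #|A| p.+1; first by move/eqP; exists A.
have {}leA : #|A| <= p by rewrite -ltnS ltn_neqAle neqA.
have [S sAS cardS] := IHp leA (ltnW leT).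
have /card_gt0P[x] : 0 < #|~: S| by rewrite cardsCs setCK cardS subn_gt0.
rewrite inE => xS; exists (x |: S); last by rewrite cardsU1 xS cardS.
exact: subset_trans sAS (subsetUr _ _).
Qed.

Section LowerBound.
Variables (n k : nat) (c : {ffun edge n -> 'I_k}).
Hypotheses (n6 : 6 <= n) (pqc : pq_coloring 6 14 c).

(** If removing [e1] and [e2] loses no color, because [f1] and [f2] have the same
colors, then the four edges have more than six vertices.  The case [f1 = f2] is
that of a color used three times. *)
Lemma two_repeats (e1 e2 f1 f2 : edge n) : e1 != e2 ->
    f1 \notin [set e1; e2] -> f2 \notin [set e1; e2] ->
    c f1 = c e1 -> c f2 = c e2 ->
  6 < #|(val e1 :|: val f1) :|: (val e2 :|: val f2)|.
Proof.
move=> ne nf1 nf2 c1 c2; rewrite ltnNge; apply/negP => le6.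
have [|S] := @superset_card _ ((val e1 :|: val f1) :|: (val e2 :|: val f2)) 6.
  by rewrite le6 card_ord.
rewrite !subUset => /andP[/andP[e1S f1S] /andP[e2S f2S]] cardS.
have := forallP pqc S; rewrite cardS eqxx /= leqNgt => /negP[]; rewrite ltnS.
pose ES := [set e : edge n | val e \subset S].
have eES : [set e1; e2] \subset ES by rewrite subUset !sub1set !inE e1S e2S.
have cardE : #|ES :\: [set e1; e2]| = 13.
  by rewrite cardsDS // card_edges_in cardS cards2 ne.
rewrite -cardE; apply: leq_trans (leq_imset_card c _).
apply/subset_leq_card/subsetP => _ /imsetP[e eS ->].
have [eE|neE] := boolP (e \in [set e1; e2]); last by apply: imset_f; rewrite inE neE.
case/set2P: eE => ->.
  by rewrite -c1; apply: imset_f; rewrite inE nf1 inE.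
by rewrite -c2; apply: imset_f; rewrite inE nf2 inE.
Qed.

Let color_class i := [set e | c e == i].

Lemma card_color_class i : #|color_class i| <= 2.
Proof.
rewrite leqNgt; apply/negP => /card_gt2P[e1 [e2 [e3 [[]]]]].
rewrite !inE => /eqP c1 /eqP c2 /eqP c3 [n12 n23 n31].
have n3 : e3 \notin [set e1; e2] by rewrite !inE negb_or n31 eq_sym n23.
have := two_repeats n12 n3 n3 (etrans c3 (esym c1)) (etrans c3 (esym c2)).
have leU (A B : {set 'I_n}) := (leq_card_setU A B).1.
rewrite -setUUl ltnNge => /negP[]; apply: leq_trans (leU _ _) _.
rewrite card_edge_val (leq_add2r 2 _ 4); apply: leq_trans (leU _ _) _.
by rewrite !card_edge_val.
Qed.

(** The vertices of the edges of color [i], and the colors used twice. *)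
Let span i := \bigcup_(e in color_class i) val e.
Let repeated := [set i | #|color_class i| == 2].

Lemma repeatedP i : i \in repeated -> exists e f : edge n,
  [/\ e != f, c e = i, c f = i & span i = val e :|: val f].
Proof.
rewrite inE => /cards2P[e [f [nef fE]]]; exists e, f.
have := set21 e f; rewrite -fE inE => /eqP ->.
have := set22 e f; rewrite -fE inE => /eqP ->.
split=> //; rewrite /span fE bigcup_setU !big_set1 //.
Qed.

Lemma card_span i : i \in repeated -> 3 <= #|span i| <= 4.
Proof.
case/repeatedP=> e [f [nef _ _ ->]]; have := cardsUI (val e) (val f).
rewrite !card_edge_val => E.
have : #|val e :&: val f| < 2.
  have := subset_leq_card (subsetIl (val e) (val f)).
  rewrite card_edge_val ltn_neqAle => ->; rewrite andbT.
  apply: contraNneq nef => I2; apply/eqP/val_inj.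
  have /eqP<- : val e :&: val f == val e by rewrite eqEcard subsetIl I2 card_edge_val.
  by apply/eqP; rewrite eqEcard subsetIr I2 card_edge_val.
by move: E; set I := #|_ :&: _|; set U := #|_ :|: _|; lia.
Qed.

Lemma span_far i j : i \in repeated -> j \in repeated -> i != j -> 6 < #|span i :|: span j|.
Proof.
case/repeatedP=> e [f [nef ce cf ->]] /repeatedP[e' [f' [nef' ce' cf' ->]]] nij.
apply: two_repeats; rewrite ?ce ?ce' //.
- by apply: contraNneq nij => E; rewrite -ce -ce' E.
- rewrite !inE negb_or eq_sym nef /=; apply: contraNneq nij => E.
  by rewrite -cf -ce' E.
rewrite !inE negb_or andbC eq_sym nef' /=; apply: contraNneq nij => E.
by rewrite -cf' -ce E.
Qed.

(** Ordered pairs charged to a repeated color: all pairs inside its span if this has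
four vertices, all pairs starting in it if it has three. *)
Let arcs i : {set 'I_n * 'I_n} :=
  [set p | [&& p.1 \in span i, p.1 != p.2 & (#|span i| == 3) || (p.2 \in span i)]].

Lemma card_arcs i : i \in repeated -> 12 <= #|arcs i|.
Proof.
move=> /card_span cS; rewrite card_set_pair (bigID (mem (span i))) /=.
apply: leq_trans (leq_addr _ _).
apply: (@leq_trans (\sum_(x in span i) if #|span i| == 3 then 5 else 3)).
  by rewrite sum_nat_const; move: cS; set w := #|_| => ?; case: eqP; lia.
apply: leq_sum => x xS.
case: ifP => [w3|w3].
  rewrite (eq_card (B := predC1 x)) ?cardC1 ?card_ord; first lia.
  by move=> y; rewrite !inE /= xS w3 andbT eq_sym.
rewrite (eq_card (B := span i :\ x)).
  by have := cardsD1 x (span i); rewrite xS; move: cS w3; lia.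
by move=> y; rewrite !inE /= xS w3 eq_sym.
Qed.

Lemma arcs_disjoint i j p : i \in repeated -> j \in repeated ->
  p \in arcs i -> p \in arcs j -> i = j.
Proof.
move=> iR jR; rewrite !inE => /and3P[p1i np pi] /and3P[p1j _ pj].
apply/eqP; apply: contraT => nij; have far := span_far iR jR nij.
have := cardsUI (span i) (span j); have /andP[_ ci] := card_span iR.
have /andP[_ cj] := card_span jR.
have I1 : 0 < #|span i :&: span j| by apply/card_gt0P; exists p.1; rewrite inE p1i.
have I2 : p.2 \in span i -> p.2 \in span j -> 1 < #|span i :&: span j|.
  move=> p2i p2j; apply/card_gt1P; exists p.1, p.2.
  by rewrite !inE p1i p1j p2i p2j.
move: far I1 I2 ci cj pi pj.
set I := #|_ :&: _|; set U := #|_ :|: _|; set w := #|span i|; set w' := #|span j|.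
by case: (p.2 \in span i); case: (p.2 \in span j) => /=; lia.
Qed.

Lemma card_repeated : 6 * #|repeated| <= 'C(n, 2).
Proof.
have: #|repeated| * 12 <= n * n.-1.
  rewrite -sum_nat_const; apply: (@leq_trans (\sum_(i in repeated) #|arcs i|)).
    by apply: leq_sum => i; apply: card_arcs.
  under eq_bigr do rewrite -sum1_card.
  rewrite (exchange_big_dep (fun p => p.1 != p.2)) /=; last first.
    by move=> i p _; rewrite inE => /and3P[].
  apply: (@leq_trans (\sum_(p : 'I_n * 'I_n | p.1 != p.2) 1)).
    apply: leq_sum => p _; rewrite sum1dep_card; apply/card_le1_eqP => i j.
    move=> /setIdP[iR ip] /setIdP[jR jp]; exact: (arcs_disjoint jR iR jp ip).
  rewrite sum1dep_card card_set_pair (eq_bigr (fun=> n.-1)).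
    by rewrite sum_nat_const card_ord.
  move=> x _; rewrite -[in RHS](card_ord n) -(cardC1 x); apply: eq_card => y.
  by rewrite !inE eq_sym.
by have := mul_bin_diag n 1; rewrite bin1; lia.
Qed.

Lemma five_sixths_le_colors : 5 * 'C(n, 2) <= 6 * k.
Proof.
suff: 'C(n, 2) <= k + #|repeated| by have := card_repeated; lia.
have -> : 'C(n, 2) = \sum_i #|color_class i|.
  rewrite -card_edge -sum1_card (partition_big c xpredT) //=.
  by apply: eq_bigr => i _; rewrite sum1dep_card.
have -> : k + #|repeated| = \sum_(i < k) (1 + (i \in repeated)).
  by rewrite big_split /= sum1_card card_ord -[in LHS]sum1_card big_mkcond.
by apply: leq_sum => i _; have := card_color_class i; rewrite inE; case: eqP; lia.
Qed.
End LowerBound.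

(** * The generalized Ramsey number *)

Local Open Scope ring_scope.

Theorem theorem5 :
  (forall n : nat, (6 <= n)%N ->
     5 / 6 * 'C(n, 2)%:R <= (gen_ramsey n 6 14)%:R :> rat) /\
  (exists C : rat, forall n : nat, (6 <= n)%N ->
     (gen_ramsey n 6 14)%:R <= 5 / 6 * 'C(n, 2)%:R + C * n%:R :> rat) /\
  (forall n : nat, (6 <= n)%N ->
     n = 1 %[mod 12] \/ n = 4 %[mod 12] ->
     (gen_ramsey n 6 14)%:R = 5 / 6 * 'C(n, 2)%:R :> rat).
Proof.
have grP n := @gen_ramseyP n 6 14 isT.
have lower n : (6 <= n)%N -> (5 * 'C(n, 2) <= 6 * gen_ramsey n 6 14)%N.
  by move=> n6; have [/existsP[c pqc] _] := grP n; apply: five_sixths_le_colors pqc.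
have upper u m : (6 <= m <= 3 * u + 1)%N -> (u %% 4 < 2)%N ->
    (6 * gen_ramsey m 6 14 <= 5 * 'C(3 * u + 1, 2))%N.
  move=> /andP[m6 le_m] u4; rewrite addn1 in le_m *.
  have [|k colk le_k] :=
      colorable_of_steiner4 _ (steiner4_of_gdd3 (gdd3_exists u4)); first lia.
  by apply: leq_trans le_k; rewrite leq_mul2l (grP m).2 // (pq_colorable_leq le_m).
have le_rat (a b : nat) : (5 * a <= 6 * b)%N -> 5 / 6 * a%:R <= b%:R :> rat.
  by move=> le_ab; rewrite -(ler_nat rat) !natrM in le_ab; lra.
have ge_rat (a b : nat) : (6 * b <= 5 * a)%N -> b%:R <= 5 / 6 * a%:R :> rat.
  by move=> le_ab; rewrite -(ler_nat rat) !natrM in le_ab; lra.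
split=> [n n6|]; first exact/le_rat/lower.
split=> [|n n6 n12].
  exists (75 / 6) => n n6.
  have [u [u4 /andP[le_nu le_un]]] : exists u, (u %% 4 < 2)%N /\ (n <= 3 * u + 1 <= n + 9)%N.
    have [r2|r2] := ltnP (n %% 12) 2; first by exists (4 * (n %/ 12))%N; lia.
    have [r5|r5] := ltnP (n %% 12) 5; first by exists (4 * (n %/ 12) + 1)%N; lia.
    by exists (4 * (n %/ 12) + 4)%N; lia.
  have le_bin : ('C(3 * u + 1, 2) <= 'C(n, 2) + 15 * n)%N.
    apply: leq_trans (leq_bin2l 2 le_un) _.
    have := mul_bin_diag (n + 9) 1; have := mul_bin_diag n 1; rewrite !bin1; nia.
  have: (6 * gen_ramsey n 6 14 <= 5 * 'C(n, 2) + 75 * n)%N.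
    have := @upper u n _ u4; rewrite n6 le_nu => /(_ isT)/leq_trans; apply; lia.
  by rewrite -(ler_nat rat) natrD !natrM; lra.
have [u [u4 nE]] : exists u, (u %% 4 < 2)%N /\ n = (3 * u + 1)%N.
  by exists (n %/ 3)%N; lia.
apply/eqP; rewrite eq_le le_rat ?lower // andbT; apply: ge_rat.
by rewrite {2}nE upper // -nE n6 leqnn.
Qed.
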